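(* Let $\ell,s,n_1,\dots,n_\ell,k_1,\dots,k_\ell$ be positive integers with $n_i\geq 8\ell^2k_i^2s$ for $i=1,\dots,\ell$. Let $V_1,\dots,V_\ell$ be pairwise disjoint sets with $|V_i|=n_i$, and let $\mathcal{F}_1,\dots,\mathcal{F}_s\subseteq \sqcup_{i=1}^\ell \binom{V_i}{k_i}$. If $\mathcal{F}_1,\dots,\mathcal{F}_s$ are rainbow matching free, then there exists $1\leq t\leq s$ such that \[ |\mathcal{F}_t|\leq \max_{1\leq i\leq \ell}\left[\binom{n_i}{k_i}-\binom{n_i-s+1}{k_i}\right]\prod_{1\leq j\leq \ell,\ j\neq i}\binom{n_j}{k_j}. \]
   Context: For pairwise disjoint finite sets $V_1,\dots,V_\ell$ and integers $k_1,\dots,k_\ell$, the direct product $\sqcup_{i=1}^\ell \binom{V_i}{k_i}$ is the collection of all subsets $F$ of $\bigcup_{i=1}^\ell V_i$ with $|F\cap V_i|=k_i$ for every $i$. Families $\mathcal{F}_1,\dots,\mathcal{F}_s$ contain a rainbow matching if there exist pairwise disjoint sets $F_1\in\mathcal{F}_1,\dots,F_s\in\mathcal{F}_s$; they are rainbow matching free if they do not contain a rainbow matching. *)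

(* Defs.v *)
From mathcomp Require Import all_boot.

Set Implicit Arguments.
Unset Strict Implicit.
Unset Printing Implicit Defensive.

Definition pairwise_disjoint (T I : finType) (V : I -> {set T}) : Prop :=
  forall i j : I, i != j -> [disjoint V i & V j].

Definition direct_product (T : finType) (l : nat)
    (V : 'I_l -> {set T}) (k : 'I_l -> nat) : {set {set T}} :=
  [set A : {set T} |
    (A \subset \bigcup_(i < l) V i) && [forall i : 'I_l, #|A :&: V i| == k i]].

Definition has_rainbow_matching (T : finType) (s : nat)
    (F : 'I_s -> {set {set T}}) : Prop :=
  exists M : 'I_s -> {set T},
    (forall t : 'I_s, M t \in F t) /\ pairwise_disjoint M.

Definition rainbow_matching_free (T : finType) (s : nat)
    (F : 'I_s -> {set {set T}}) : Prop :=
  ~ has_rainbow_matching F.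

(* Main.v *)
Require Import Defs.
From mathcomp Require Import all_boot.
From mathcomp Require Import zify.

(* Write s for the number of families, p = max_i k_i / n_i, and N for the size
   of the product a family lives in.  Induct on s.
   - If the link of some vertex v in some F_j has density above 1/8 in its own
     product, take by induction a rainbow matching of the other families that
     avoids v; it meets at most 1/8 of the product, so the link contains a set
     disjoint from it.
   - Otherwise call v rich for F_j if its link there has density above
     2 (s - 1) p.  If every family has at least s rich vertices, choose distinct
     ones v_j; after discarding the sets through the other v_i the link of v_j
     still has density above (s - 1) p, and a rainbow matching of these links
     extends by the v_j.
   - Otherwise some F_j has fewer than s rich vertices.  If a rainbow matching of
     the other families does not extend, its vertices cover F_j, and bounding the
     degrees of the rich and of the other vertices gives
     |F_j| <= (3/7) (s - 1) p N.
   This step (rainbow_step) is used twice: with the threshold (s - 1) p N, for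
   families of mixed types and by induction on the total size of the types, which
   deals with the links; and with the sharp threshold of the theorem, whose
   induction deletes a vertex from the ground set. *)

Set Implicit Arguments.
Unset Strict Implicit.
Unset Printing Implicit Defensive.

(** * Finite sums and distinct representatives *)

Lemma card_bigcup_leq (T I : finType) (P : pred I) (A : I -> {set T}) :
  #|\bigcup_(i | P i) A i| <= \sum_(i | P i) #|A i|.
Proof.
elim/big_ind2: _ => [|m B n C le1 le2|//]; first by rewrite cards0.
exact: leq_trans (leq_card_setU _ _).1 (leq_add le1 le2).
Qed.

Lemma leq_sum_const (I : finType) (A : {set I}) (f : I -> nat) (c d : nat) :
  (forall i, i \in A -> d * f i <= c) -> d * \sum_(i in A) f i <= #|A| * c.
Proof. by move=> h; rewrite big_distrr /= -sum_nat_const leq_sum. Qed.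

(** Greedy choice: the representatives of the other |J| - 1 sets leave some element of [H i] free.
    [x0] fills the base case, where [J] is empty. *)
Lemma distinct_representatives (T I : finType) (x0 : T) (H : I -> {set T})
    (J : {set I}) :
  (forall i, i \in J -> #|J| <= #|H i|) ->
  exists v : I -> T, (forall i, i \in J -> v i \in H i) /\ {in J &, injective v}.
Proof.
have [m] := ubnP #|J|; elim: m => // m IH in J *.
have [-> _ _|[i iJ] ltJ hH] := set_0Vmem J.
  by exists (fun=> x0); split=> j; rewrite inE.
have cJ := cardsD1 i J; rewrite iJ in cJ.
have [|j /setD1P[_ jJ]|v [vH vI]] := IH (J :\ i); first by lia.
  by have := hH j jJ; lia.
have [x xH xv] : exists2 x, x \in H i & x \notin [set v j | j in J :\ i].
  apply/subsetPn; apply: contraTN (hH i iJ) => /subset_leq_card.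
  have : #|[set v j | j in J :\ i]| <= #|J :\ i| by apply: leq_imset_card.
  by lia.
have xNv j : j \in J -> j != i -> v j <> x.
  by move=> jJ ji vj; case/negP: xv; apply/imsetP; exists j; rewrite ?inE ?ji.
exists (fun j => if j == i then x else v j); split=> [j jJ|j j' jJ j'J].
  by case: eqVneq => [->|ji] //; apply: vH; rewrite !inE ji.
case: eqVneq => [->|ji]; case: eqVneq => [-> //|j'i].
- by move=> /esym /xNv; case.
- by move=> /xNv; case.
- by apply: vI; rewrite !inE ?ji ?j'i.
Qed.

(** * Links, stars and rainbow matchings of indexed families *)

Section Families.

Variables (T I : finType).
Implicit Types (G : {set {set T}}) (D X : {set T}) (J : {set I}).
Implicit Types (F : I -> {set {set T}}) (M : I -> {set T}).

Definition avoid G D : {set {set T}} := [set X in G | [disjoint X & D]].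
Definition star G (v : T) : {set {set T}} := [set X in G | v \in X].
Definition link G (v : T) : {set {set T}} :=
  [set X : {set T} | (v \notin X) && (v |: X \in G)].

(** Restricting to a subset [J] of a fixed index type lets inductions drop an index without changing
    the type of [F]; values of [M] outside [J] are free. *)
Definition rainbow J (F : I -> {set {set T}}) : Prop :=
  exists M : I -> {set T}, (forall i, i \in J -> M i \in F i) /\
    {in J &, forall i j, i != j -> [disjoint M i & M j]}.

Lemma rainbow_extend J F i M X :
  (forall j, j \in J :\ i -> M j \in F j) ->
  {in J :\ i &, forall j j', j != j' -> [disjoint M j & M j']} ->
  X \in F i -> [disjoint X & \bigcup_(j in J :\ i) M j] -> rainbow J F.
Proof.
move=> MF Md XF dX.
have dXM j : j \in J -> j != i -> [disjoint X & M j].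
  move=> jJ ji; apply: disjointWr dX.
  by apply: (bigcup_sup j) => //; rewrite !inE ji.
exists (fun j => if j == i then X else M j); split=> [j jJ|j j' jJ j'J].
  by case: eqVneq => [->|ji] //; apply: MF; rewrite !inE ji.
case: (eqVneq j i) => [->|ji]; case: (eqVneq j' i) => [_|j'i] //.
- by move=> _; apply: dXM.
- by move=> _; rewrite disjoint_sym; apply: dXM.
- by apply: Md; rewrite !inE ?ji ?j'i.
Qed.

Lemma card_star_link G v : #|star G v| = #|link G v|.
Proof.
have <- : [set v |: Y | Y in link G v] = star G v.
  apply/setP=> X; apply/imsetP/idP => [[Y]|].
    by rewrite !inE => /andP[_ YG] ->; rewrite YG !inE eqxx.
  rewrite inE => /andP[XG vX]; exists (X :\ v); last by rewrite setD1K.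
  by rewrite !inE eqxx setD1K.
rewrite card_in_imset // => X Y; rewrite !inE => /andP[vX _] /andP[vY _] e.
by rewrite -(setU1K vX) e setU1K.
Qed.

Lemma card_avoid1 G v : #|G| = #|avoid G [set v]| + #|star G v|.
Proof.
rewrite -(cardsID (star G v) G) addnC; congr (_ + _); apply: eq_card => X.
  by rewrite !inE disjoint_sym disjoints1; case: (X \in G); rewrite ?andbF ?andbT.
by rewrite !inE; case: (X \in G).
Qed.

Lemma card_avoid G D : #|G| <= #|avoid G D| + \sum_(v in D) #|star G v|.
Proof.
have le : G \subset avoid G D :|: \bigcup_(v in D) star G v.
  apply/subsetP=> X XG; rewrite !inE XG /=; apply/orP.
  case: (boolP [disjoint X & D]) => [|/pred0Pn[x /andP[xX xD]]]; [by left|right].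
  by apply/bigcupP; exists x => //; rewrite inE XG.
apply: leq_trans (subset_leq_card le) _.
apply: leq_trans (leq_card_setU _ _).1 _; rewrite leq_add2l.
exact: card_bigcup_leq.
Qed.

End Families.

(** * Direct products and the degrees of their vertices *)

Section DirectProducts.

Variables (T : finType) (l : nat).
Implicit Types (V : 'I_l -> {set T}) (G : {set {set T}}) (D M X : {set T}).
Implicit Types (kap : 'I_l -> nat).

Lemma direct_product_sub V kap X :
  X \in direct_product V kap -> X \subset \bigcup_(i < l) V i.
Proof. by rewrite inE => /andP[]. Qed.

Lemma direct_product_card V kap X i :
  X \in direct_product V kap -> #|X :&: V i| = kap i.
Proof. by rewrite inE => /andP[_ /forallP/(_ i)/eqP]. Qed.

(** [X] is encoded by its traces [X :&: V i]; by disjointness the union of any draws [g i] has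
    exactly these as traces. *)
Lemma card_direct_product V kap : pairwise_disjoint V ->
  #|direct_product V kap| = \prod_(i < l) 'C(#|V i|, kap i).
Proof.
move=> disjV; under eq_bigr do rewrite -cards_draws.
rewrite -cardsXn.
pose f X : {ffun 'I_l -> {set T}} := [ffun i => X :&: V i].
have fI : {in direct_product V kap &, injective f}.
  have fX X : X \in direct_product V kap -> \bigcup_(i < l) f X i = X.
    move=> /direct_product_sub XV; under eq_bigr do rewrite ffunE.
    by rewrite -big_distrr /=; apply/setIidPl.
  by move=> X Y /fX {2}<- /fX {2}<- ->.
rewrite -(card_in_imset fI); apply: eq_card => g.
apply/imsetP/setXnP => [[X Xd -> i]|gP].
  by rewrite ffunE inE subsetIr (direct_product_card i Xd) eqxx.
have gV i : g i \subset V i by have := gP i; rewrite inE => /andP[].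
have gE i : (\bigcup_j g j) :&: V i = g i.
  apply/setP=> x; rewrite inE; apply/andP/idP => [[/bigcupP[j _ xj] xi]|xi].
    case: (eqVneq j i) => [<- //|/disjV/pred0P/(_ x)/=].
    by rewrite (subsetP (gV j) _ xj) xi.
  by split; [apply/bigcupP; exists i | apply: (subsetP (gV i))].
exists (\bigcup_i g i); last by apply/ffunP=> i; rewrite ffunE gE.
rewrite inE; apply/andP; split.
  by apply/bigcupsP=> i _; apply: subset_trans (gV i) (bigcup_sup i _).
by apply/forallP=> i; rewrite gE; have := gP i; rewrite inE => /andP[].
Qed.


Lemma pairwise_disjointD V D :
  pairwise_disjoint V -> pairwise_disjoint (fun i => V i :\: D).
Proof.
move=> disjV i j /disjV; apply: disjointW; exact: subsetDl.
Qed.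

Lemma avoid_direct_product V kap G D : G \subset direct_product V kap ->
  avoid G D \subset direct_product (fun i => V i :\: D) kap.
Proof.
move=> /subsetP GV; apply/subsetP=> X; rewrite inE => /andP[/GV XV XD].
have XVD i : X :&: (V i :\: D) = X :&: V i.
  by rewrite setIDA; apply/setDidPl; apply: disjointWl XD; apply: subsetIl.
rewrite inE; apply/andP; split; last first.
  by apply/forallP=> i; rewrite XVD (direct_product_card i XV).
apply/subsetP=> x xX; have /bigcupP[i _ xi] := subsetP (direct_product_sub XV) x xX.
by apply/bigcupP; exists i => //; rewrite inE (disjointFr XD xX).
Qed.

Definition pred_at (a : 'I_l) kap : 'I_l -> nat := fun i => kap i - (i == a).

Lemma link_direct_product V kap G v a : pairwise_disjoint V -> v \in V a ->
  G \subset direct_product V kap ->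
  link G v \subset direct_product V (pred_at a kap).
Proof.
move=> disjV va /subsetP GV; apply/subsetP=> X; rewrite inE => /andP[vX /GV XV].
rewrite inE; apply/andP; split.
  by apply: subset_trans (direct_product_sub XV); apply: subsetUr.
apply/forallP=> i; have := direct_product_card i XV; rewrite setIUl /pred_at.
case: (eqVneq i a) => [-> <-|ia <-].
  have /setIidPl -> : [set v] \subset V a by rewrite sub1set.
  by rewrite cardsU1 inE (negbTE vX) add1n subn1.
have /disjoint_setI0 -> : [disjoint [set v] & V i]; last by rewrite set0U subn0.
by rewrite disjoints1; apply/negP=> vi; have /pred0P/(_ v)/= := disjV _ _ ia; rewrite vi va.
Qed.

Lemma star_pred0 V kap G v a : v \in V a ->
  G \subset direct_product V kap -> kap a = 0 -> #|star G v| = 0.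
Proof.
move=> va /subsetP GV k0; apply/eqP; rewrite cards_eq0; apply/eqP/setP=> X.
rewrite !inE; apply/negP=> /andP[/GV /(direct_product_card a)].
by rewrite k0 => /eqP; rewrite cards_eq0 => /eqP/setP/(_ v); rewrite !inE va andbT => ->.
Qed.

(** The link of [v] avoids [v], so it lies in a product over [V a :\ v], and n C(n-1, k-1) = k C(n,
    k). *)
Lemma card_star_leq V kap G v a : pairwise_disjoint V -> v \in V a ->
  G \subset direct_product V kap ->
  #|V a| * #|star G v| <= kap a * #|direct_product V kap|.
Proof.
move=> disjV va GV; case ka: (kap a) => [|m].
  by rewrite (star_pred0 va GV ka) muln0.
have disjVv := pairwise_disjointD [set v] disjV.
have : #|star G v| <= #|direct_product (fun i => V i :\: [set v]) (pred_at a kap)|.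
  rewrite card_star_link; apply: subset_leq_card.
  apply: subset_trans (avoid_direct_product [set v] (link_direct_product disjV va GV)).
  apply/subsetP=> X XG; rewrite inE XG disjoint_sym disjoints1.
  by move: XG; rewrite inE => /andP[].
have VE i : i != a -> V i :\ v = V i.
  move=> ia; apply/setDidPl; rewrite disjoint_sym disjoints1; apply/negP=> vi.
  by have /pred0P/(_ v)/= := disjV _ _ ia; rewrite vi va.
rewrite card_direct_product // (bigD1 a) //= /pred_at eqxx subn1 ka /=.
rewrite (eq_bigr (fun i => 'C(#|V i|, kap i))) => [|i ia]; last first.
  by rewrite VE // (negbTE ia) subn0.
have -> : #|V a :\ v| = #|V a|.-1 by rewrite [in RHS](cardsD1 v) va.
move=> le; apply: leq_trans (leq_mul (leqnn _) le) _.
by rewrite card_direct_product // [in leqRHS](bigD1 a) //= ka !mulnA mul_bin_diag.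
Qed.

(** The link's product is taken here over all of [V a], so that the ground set stays fixed; the
    ratio becomes k / (n - k + 1) in place of k / n. *)
Lemma card_pred_at V kap a : pairwise_disjoint V -> 0 < kap a ->
  (#|V a| - (kap a).-1) * #|direct_product V (pred_at a kap)| =
  kap a * #|direct_product V kap|.
Proof.
move=> disjV; case ka: (kap a) => [//|m] _.
rewrite !card_direct_product // (bigD1 a) // [in RHS](bigD1 a) //= /pred_at.
rewrite eqxx ka subn1 !mulnA mul_bin_left; congr (_ * _).
by apply: eq_bigr => i /negbTE->; rewrite subn0.
Qed.

Lemma sum_pred_at kap a : 0 < kap a ->
  (\sum_(i < l) pred_at a kap i).+1 = \sum_(i < l) kap i.
Proof.
move=> ka; rewrite (bigD1 a) // [RHS](bigD1 a) //= /pred_at eqxx -addSn.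
rewrite subn1 prednK //; congr (_ + _).
by apply: eq_bigr => i /negbTE->; rewrite subn0.
Qed.

End DirectProducts.

(** * Degree sums over sparse vertex sets *)

Lemma leq_sum_cover (T : finType) (l : nat) (V : 'I_l -> {set T}) (M : {set T})
    (f : T -> nat) : M \subset \bigcup_(i < l) V i ->
  \sum_(v in M) f v <= \sum_(i < l) \sum_(v in M :&: V i) f v.
Proof.
move=> /subsetP MV; rewrite (exchange_big_dep (mem M)) /=; last first.
  by move=> i v _; rewrite inE => /andP[].
apply: leq_sum => v vM; have /bigcupP[i _ vi] := MV v vM.
by rewrite (bigD1 i) ?inE ?vM //= leq_addr.
Qed.

(** Part i holds at most r k_i vertices of [M], each of weight at most c k_i / n_i, and so
    contributes at most r k_i^2 c / n_i <= c / (8 l); there are l parts. *)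
Lemma leq_sum_sparse (T : finType) (l : nat) (V : 'I_l -> {set T})
    (k : 'I_l -> nat) (r c : nat) (M : {set T}) (f : T -> nat) :
  0 < l -> M \subset \bigcup_(i < l) V i ->
  (forall i, #|M :&: V i| <= r * k i) ->
  (forall i, 8 * l * r * k i ^ 2 <= #|V i|) ->
  (forall i v, v \in M -> v \in V i -> #|V i| * f v <= c * k i) ->
  8 * \sum_(v in M) f v <= c.
Proof.
move=> l0 MV Mr nk fc; have le := leq_sum_cover f MV.
suff : 8 * l * \sum_(i < l) \sum_(v in M :&: V i) f v <= l * c by nia.
rewrite big_distrr /= -[l in leqRHS]card_ord -sum_nat_const; apply: leq_sum => i _.
have [-> |[v /setIP[_ vi]]] := set_0Vmem (M :&: V i); first by rewrite big_set0 muln0.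
have n0 : 0 < #|V i| by apply/card_gt0P; exists v.
have h : #|V i| * \sum_(v in M :&: V i) f v <= #|M :&: V i| * (c * k i).
  by apply: leq_sum_const => u /setIP[uM ui]; apply: fc.
rewrite -(leq_pmul2l n0).
have := Mr i; have := nk i; move: h; set S := \sum_(_ in _) _.
set n := #|V i|; set m := #|M :&: V i|; move: (k i) => x h1 h2 h3.
have h4 : 8 * l * (n * S) <= 8 * l * (r * x * (c * x)).
  by rewrite leq_mul2l (leq_trans h1) ?orbT // leq_mul2r h3 orbT.
have h5 : 8 * l * r * x ^ 2 * c <= n * c by rewrite leq_mul2r h2 orbT.
by apply: leq_trans h5; apply: leq_trans (leq_trans _ h4) _; rewrite ?mulnA; lia.
Qed.

Lemma card_matching_part (T I : finType) (l : nat) (V : 'I_l -> {set T})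
    (k : 'I_l -> nat) (kap : I -> 'I_l -> nat) (J : {set I}) (M : I -> {set T}) i :
  (forall j, j \in J -> M j \in direct_product V (kap j)) ->
  (forall j, j \in J -> kap j i <= k i) ->
  #|(\bigcup_(j in J) M j) :&: V i| <= #|J| * k i.
Proof.
move=> MV kk; rewrite big_distrl /= -sum_nat_const.
apply: leq_trans (card_bigcup_leq _ _) _; apply: leq_sum => j jJ.
by rewrite (direct_product_card i (MV j jJ)) kk.
Qed.

(** A vertex of part i lies in at most a k_i / n_i share of the product, so the members of [G] that
    meet [M] number at most 1/8 of the product, fewer than [G] has. *)
Lemma exists_avoid (T : finType) (l : nat) (V : 'I_l -> {set T})
    (k kap : 'I_l -> nat) (r : nat) (M : {set T}) (G : {set {set T}}) :
  0 < l -> pairwise_disjoint V ->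
  (forall i, 8 * l * r * k i ^ 2 <= #|V i|) -> (forall i, kap i <= k i) ->
  M \subset \bigcup_(i < l) V i -> (forall i, #|M :&: V i| <= r * k i) ->
  G \subset direct_product V kap -> #|direct_product V kap| < 8 * #|G| ->
  exists2 X, X \in G & [disjoint X & M].
Proof.
move=> l0 disjV nk kk MV Mr GV big.
have h : 8 * \sum_(v in M) #|star G v| <= #|direct_product V kap|.
  apply: (leq_sum_sparse l0 MV Mr nk) => i v _ vi.
  apply: leq_trans (card_star_leq disjV vi GV) _.
  by rewrite mulnC leq_mul2l kk orbT.
have := card_avoid G M => h2.
have /card_gt0P[X] : 0 < #|avoid G M| by lia.
by rewrite inE => /andP[]; exists X.
Qed.

(** * The extension step and the threshold for mixed types *)

(** Here p = a / b. The last two hypotheses stand for the induction hypotheses: one family fewer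
    with a vertex avoided, and equally many families of smaller total type. Each use supplies them
    by its own induction. *)
Lemma rainbow_step (T I : finType) (l : nat) (V : 'I_l -> {set T})
    (k : 'I_l -> nat) (a b : nat) (J : {set I}) (F : I -> {set {set T}})
    (kap : I -> 'I_l -> nat) (v0 : T) :
  0 < l -> pairwise_disjoint V -> v0 \in \bigcup_(i < l) V i ->
  (forall i, 8 * l * #|J| * k i ^ 2 <= #|V i|) ->
  (forall i, k i * b <= a * #|V i|) ->
  (forall j, j \in J -> F j \subset direct_product V (kap j)) ->
  (forall j i, j \in J -> kap j i <= k i) ->
  (forall j, j \in J ->
    3 * (#|J|.-1 * a * #|direct_product V (kap j)|) < 7 * (b * #|F j|)) ->
  (forall j v, j \in J -> v \in \bigcup_(i < l) V i ->
    rainbow (J :\ j) (fun i => avoid (F i) [set v])) ->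
  (forall (G : I -> {set {set T}}) (kap' : I -> 'I_l -> nat),
    (forall j, j \in J -> G j \subset direct_product V (kap' j)) ->
    (forall j i, j \in J -> kap' j i <= k i) ->
    (forall j, j \in J ->
      #|J|.-1 * a * #|direct_product V (kap' j)| < b * #|G j|) ->
    \sum_(j in J) \sum_i kap' j i < \sum_(j in J) \sum_i kap j i ->
    rainbow J G) ->
  rainbow J F.
Proof.
move=> l0 disjV v0V nkJ pk FV kk big sub links.
have [->|[j0 j0J]] := set_0Vmem J.
  by exists (fun=> set0); split=> j; rewrite inE.
set r := #|J|.-1 in big links.
have rJ : r.+1 = #|J| by rewrite prednK //; apply/card_gt0P; exists j0.
have card_J1 j : j \in J -> #|J :\ j| = r.
  by move=> jJ; rewrite /r (cardsD1 j J) jJ.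
have nk i : 8 * l * r * k i ^ 2 <= #|V i| by have := nkJ i; rewrite -rJ; nia.
have k8 i : 8 * k i <= #|V i|.
  by have := nkJ i; rewrite -rJ; case: (k i) => [|x]; nia.
have linkV j v c : j \in J -> v \in V c ->
    link (F j) v \subset direct_product V (pred_at c (kap j)).
  by move=> jJ vc; apply: link_direct_product => //; apply: FV.
have pred_le j c i : j \in J -> pred_at c (kap j) i <= k i.
  by move=> jJ; rewrite /pred_at (leq_trans (leq_subr _ _)) ?kk.
(* Since 8 k_c <= n_c, the denominator n_c - k + 1 is at least 7 n_c / 8; this is the source of the
   7 in the threshold. *)
have N_pred j c : j \in J -> 0 < kap j c ->
    7 * #|V c| * #|direct_product V (pred_at c (kap j))| <=
    8 * (k c * #|direct_product V (kap j)|).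
  move=> jJ k0; have e := card_pred_at disjV k0.
  have kc := kk j c jJ; have n8 := k8 c.
  move: e; set N := #|direct_product V (kap j)|; set N' := #|direct_product V _|.
  move=> e; have h1 : kap j c * N <= k c * N by rewrite leq_mul2r kc orbT.
  have h2 : 7 * #|V c| <= 8 * (#|V c| - (kap j c).-1) by lia.
  have h3 : 7 * #|V c| * N' <= 8 * (#|V c| - (kap j c).-1) * N'.
    by rewrite leq_mul2r h2 orbT.
  by lia.
have kap_gt0 j v c : j \in J -> v \in V c -> 0 < #|link (F j) v| -> 0 < kap j c.
  move=> jJ vc; rewrite -card_star_link !lt0n; apply: contra_neq => k0.
  exact: star_pred0 vc (FV j jJ) k0.
pose W j (M : I -> {set T}) := \bigcup_(i in J :\ j) M i.
have matching_part j v M : j \in J ->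
    (forall i, i \in J :\ j -> M i \in avoid (F i) [set v]) ->
    [/\ forall i, i \in J :\ j -> M i \in F i, v \notin W j M,
        W j M \subset \bigcup_(i < l) V i
      & forall i, #|W j M :&: V i| <= r * k i].
  move=> jJ MF.
  have MF' i : i \in J :\ j -> M i \in F i by move=> /MF; rewrite inE => /andP[].
  have MV i : i \in J :\ j -> M i \in direct_product V (kap i).
    by move=> iJ; apply: (subsetP (FV i _)) (MF' i iJ); case/setD1P: iJ.
  split=> // [||i].
  - apply/bigcupP=> -[i iJ vM]; have := MF i iJ.
    by rewrite inE disjoint_sym disjoints1 vM andbF.
  - by apply/bigcupsP=> i iJ; apply: direct_product_sub (MV i iJ).
  - rewrite -(card_J1 j jJ); apply: card_matching_part MV _ => i' /setD1P[_ iJ].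
    exact: kk.
(* First case: a link of density above 1/8. *)
case: (boolP [exists j in J, [exists c, [exists v in V c,
    #|direct_product V (pred_at c (kap j))| < 8 * #|link (F j) v|]]]).
  move=> /exists_inP[j jJ /existsP[c /exists_inP[v vc heavy]]].
  have vV : v \in \bigcup_(i < l) V i by apply/bigcupP; exists c.
  have [M [MF Md]] := sub j v jJ vV.
  have [MF' vW WV Wr] := matching_part j v M jJ MF.
  have [X] := exists_avoid l0 disjV nk (fun i => pred_le j c i jJ) WV Wr
    (linkV j v c jJ vc) heavy.
  rewrite inE => /andP[vX XF] XW; apply: (rainbow_extend MF' Md XF).
  rewrite -/(W j M) disjoints_subset subUset sub1set inE vW /=.
  by rewrite -disjoints_subset.
move=> light.
have {light}light j c v : j \in J -> v \in V c ->
    8 * #|link (F j) v| <= #|direct_product V (pred_at c (kap j))|.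
  move=> jJ vc; rewrite leqNgt; apply: contra light => h.
  by apply/exists_inP; exists j => //; apply/existsP; exists c; apply/exists_inP; exists v.
pose rich j v c := (v \in V c) &&
  (2 * (r * a * #|direct_product V (pred_at c (kap j))|) < b * #|link (F j) v|).
pose H j := [set v | [exists c, rich j v c]].
(* Second case: every family has enough rich vertices for distinct representatives [w j]. *)
case: (boolP [forall j in J, #|J| <= #|H j|]).
  move=> /forall_inP/(distinct_representatives v0)[w [wH wI]].
  pose c j := odflt (Ordinal l0) [pick c | rich j (w j) c].
  have wc j : j \in J -> rich j (w j) (c j).
    move=> /wH; rewrite inE /c => /existsP[x hx].
    by case: pickP => [//|/(_ x)]; rewrite hx.
  pose D j := [set w i | i in J :\ j].
  pose G j := avoid (link (F j) (w j)) (D j).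
  have [] := links G (fun j => pred_at (c j) (kap j)).
  - move=> j jJ; have /andP[wV _] := wc j jJ.
    by apply: subset_trans (linkV j _ _ jJ wV); apply/subsetP=> X; rewrite inE => /andP[].
  - by move=> j i jJ; apply: pred_le.
  - move=> j jJ; have /andP[wV wbig] := wc j jJ; move: wbig.
    set N := #|direct_product V _| => wbig.
    (* Each of the at most [r] other representatives lies in at most p N sets of the link, so of its
       more than 2 r p N sets more than r p N stay in [G j]. *)
    have h : b * \sum_(v in D j) #|star (link (F j) (w j)) v| <= r * (a * N).
      have Dr : #|D j| <= r by rewrite -(card_J1 j jJ) leq_imset_card.
      apply: leq_trans (_ : #|D j| * (a * N) <= _); last by rewrite leq_mul2r Dr orbT.
      apply: leq_sum_const => _ /imsetP[i /setD1P[_ iJ] ->].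
      have /andP[wiV _] := wc i iJ.
      have n0 : 0 < #|V (c i)| by apply/card_gt0P; exists (w i).
      have := card_star_leq disjV wiV (linkV j (w j) (c j) jJ wV).
      have := pred_le j (c j) (c i) jJ; have := pk (c i); rewrite -/N.
      set d := #|star _ _|; set n := #|V _| in n0 *; move: (pred_at _ _ _) => x.
      move: (k (c i)) => y h1 h2 h3; rewrite -(leq_pmul2l n0).
      have h4 : b * (n * d) <= b * (y * N).
        by rewrite leq_mul2l (leq_trans h3) ?orbT // leq_mul2r h2 orbT.
      have h5 : y * b * N <= a * n * N by rewrite leq_mul2r h1 orbT.
      by lia.
    have := card_avoid (link (F j) (w j)) (D j); rewrite -/(G j) => h2.
    have h3 : b * #|link (F j) (w j)| <=
        b * (#|G j| + \sum_(v in D j) #|star (link (F j) (w j)) v|).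
      by rewrite leq_mul2l h2 orbT.
    by lia.
  (* Every type loses one unit, so the total drops by |J| > 0. *)
  - have jlt j : j \in J -> (\sum_i pred_at (c j) (kap j) i).+1 = \sum_i kap j i.
      move=> jJ; have /andP[wV wbig] := wc j jJ.
      apply: sum_pred_at; apply: (kap_gt0 j (w j)) => //; lia.
    rewrite [ltnRHS](eq_bigr _ (fun j jJ => esym (jlt j jJ))).
    under [ltnRHS]eq_bigr do rewrite -addn1.
    rewrite big_split /= sum_nat_const -rJ; lia.
  - move=> M [MG Md]; exists (fun j => w j |: M j).
    have MP j : j \in J -> [/\ w j \notin M j, w j |: M j \in F j
        & forall i, i \in J -> i != j -> w i \notin M j].
      move=> jJ; have := MG j jJ; rewrite !inE => /andP[/andP[-> ->] dM].
      split=> // i iJ ij; apply/negP=> wM; have := disjointFr dM wM.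
      by rewrite imset_f // !inE ij.
    split=> [j /MP[]//|i j iJ jJ ij].
    have [wi _ wi'] := MP i iJ; have [wj _ wj'] := MP j jJ.
    rewrite disjoints_subset subUset sub1set !inE negb_or wj' // andbT.
    apply/andP; split; first by apply: contra ij => /eqP/wI->.
    rewrite -disjoints_subset disjoint_sym disjoints_subset subUset sub1set inE.
    by rewrite wi' 1?eq_sym // -disjoints_subset disjoint_sym Md.
(* Third case: [F j] has at most [r] rich vertices. The matching of the others may avoid any vertex,
   here [v0]. *)
move=> /forall_inPn[j jJ]; rewrite -ltnNge -rJ ltnS => Hr.
have [M [MF Md]] := sub j v0 jJ v0V.
have [MF' _ WV Wr] := matching_part j v0 M jJ MF.
case: (set_0Vmem (avoid (F j) (W j M))) => [G0|[X]]; last first.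
  by rewrite inE => /andP[XF XW]; apply: (rainbow_extend MF' Md XF).
have := card_avoid (F j) (W j M); rewrite G0 cards0 add0n.
under eq_bigr do rewrite card_star_link.
rewrite (big_setID (H j)) /=; set N := #|direct_product V (kap j)| in big *.
(* A rich vertex has degree at most N' / 8 <= p N / 7, and there are at most [r] of them. *)
have hH : 7 * b * \sum_(v in W j M :&: H j) #|link (F j) v| <= r * (a * N).
  apply: leq_trans (_ : #|W j M :&: H j| * (a * N) <= _); last first.
    by rewrite leq_mul2r (leq_trans (subset_leq_card (subsetIr _ _)) Hr) orbT.
  apply: leq_sum_const => v /setIP[_]; rewrite inE => /existsP[c /andP[vc vbig]].
  have n0 : 0 < #|V c| by apply/card_gt0P; exists v.
  have k0 : 0 < kap j c by apply: (kap_gt0 j v) => //; lia.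
  have := N_pred j c jJ k0; have := light j c v jJ vc; have := pk c.
  rewrite -/N; set N' := #|direct_product V _|; set n := #|V c| in n0 *.
  set d := #|link _ _|; move: (k c) => y h1 h2 h3; rewrite -(leq_pmul2l n0).
  have h4 : 7 * n * (8 * d) <= 7 * n * N' by rewrite leq_mul2l h2 orbT.
  have h5 : b * (7 * n * d) <= b * (y * N) by rewrite leq_mul2l; lia.
  have h6 : y * b * N <= a * n * N by rewrite leq_mul2r h1 orbT.
  by lia.
(* Another vertex has degree at most 2 r p N' <= (16/7) r p N k_c / n_c; by sparsity these sum to
   (2/7) r p N. With the rich share 1/7 this makes 3/7. *)
have hL : 8 * \sum_(v in W j M :\: H j) 7 * b * #|link (F j) v| <= 16 * (r * a * N).
  apply: (leq_sum_sparse l0 _ _ nk) => [|i|c v].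
  - exact: subset_trans (subsetDl _ _) WV.
  - by apply: leq_trans (Wr i); apply/subset_leq_card/setSI/subsetDl.
  move=> /setDP[_ vH] vc; case: (posnP #|link (F j) v|) => [->|d0].
    by rewrite !muln0.
  have k0 := kap_gt0 j v c jJ vc d0; have := N_pred j c jJ k0.
  have : b * #|link (F j) v| <= 2 * (r * a * #|direct_product V (pred_at c (kap j))|).
    rewrite leqNgt; apply: contra vH => h; rewrite inE.
    by apply/existsP; exists c; rewrite /rich vc.
  rewrite -/N; set N' := #|direct_product V _|; set n := #|V c|.
  set d := #|link _ _|; move: (k c) => y h1 h2.
  have h3 : 7 * n * (b * d) <= 7 * n * (2 * (r * a * N')) by rewrite leq_mul2l h1 orbT.
  have h4 : 2 * (r * a) * (7 * n * N') <= 2 * (r * a) * (8 * (y * N)).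
    by rewrite leq_mul2l h2 orbT.
  by lia.
rewrite -big_distrr /= in hL; have := big j jJ; rewrite -/N => h1 h2.
have h3 := leq_mul (leqnn (7 * b)) h2.
exfalso; move: h1 h3 hH hL; rewrite mulnDr [7 * (b * _)]mulnA [r * (a * N)]mulnA.
move: (7 * b * \sum_(i in _ :&: _) _) (7 * b * \sum_(i in _ :\: _) _).
by move: (7 * b * #|F j|) (r * a * N) => x y; lia.
Qed.

(* Each |F j| exceeds (s - 1) p N with p = a / b >= max k_i / n_i, written
   without division. *)
Lemma rainbow_of_dense (T I : finType) (l : nat) (V : 'I_l -> {set T})
    (k : 'I_l -> nat) (a b : nat) (J : {set I}) (F : I -> {set {set T}})
    (kap : I -> 'I_l -> nat) (v0 : T) :
  0 < l -> pairwise_disjoint V -> v0 \in \bigcup_(i < l) V i ->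
  (forall i, 8 * l * #|J| * k i ^ 2 <= #|V i|) ->
  (forall i, k i * b <= a * #|V i|) ->
  (forall j, j \in J -> F j \subset direct_product V (kap j)) ->
  (forall j i, j \in J -> kap j i <= k i) ->
  (forall j, j \in J ->
    #|J|.-1 * a * #|direct_product V (kap j)| < b * #|F j|) ->
  rainbow J F.
Proof.
move=> l0 disjV v0V nk pk.
(* Both inductions lower this measure: dropping a family lowers |J|, passing to links lowers the
   types. *)
have [m] := ubnP (#|J| + \sum_(j in J) \sum_i kap j i).
elim: m => // m IH in J F kap nk *; move=> ltm FV kk big.
apply: (@rainbow_step _ _ _ V k a b J F kap v0) => // [j jJ|j v jJ|G kap' GV kk' Gbig lts].
- by have := big j jJ; lia.
- case/bigcupP=> c _ vc; have cJ := cardsD1 j J; rewrite jJ add1n in cJ.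
  have JJ i : i \in J :\ j -> i \in J by case/setD1P.
  apply: (IH _ _ kap) => [i||i iJ|i c' iJ|i iJ]; try exact/kk/JJ.
  + by apply: leq_trans (nk i); rewrite leq_mul2r leq_mul2l cJ leqnSn !orbT.
  + have : \sum_(i in J :\ j) \sum_c kap i c <= \sum_(i in J) \sum_c kap i c.
      by rewrite [leqRHS](big_setD1 j) //= leq_addl.
    by move: ltm; rewrite cJ; lia.
  + apply: subset_trans (FV i (JJ i iJ)).
    by apply/subsetP=> X; rewrite inE => /andP[].
  (* Avoiding [v] costs at most p N sets, exactly what the threshold loses with one family fewer. *)
  + have n0 : 0 < #|V c| by apply/card_gt0P; exists v.
    have /card_gt0P J0 : exists i, i \in J :\ j by exists i.
    have := card_star_leq disjV vc (FV i (JJ i iJ)).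
    have := big i (JJ i iJ); have := kk i c (JJ i iJ); have := pk c.
    rewrite (card_avoid1 (F i) v) cJ /=.
    set N := #|direct_product V _|; set d := #|star _ _|; set n := #|V c| in n0 *.
    move: (k c) (kap i c) #|avoid _ _| => y x f h1 h2 h3 h4.
    have h5 : b * (n * d) <= b * (y * N).
      by rewrite leq_mul2l (leq_trans h4) ?orbT // leq_mul2r h2 orbT.
    have h6 : y * b * N <= a * n * N by rewrite leq_mul2r h1 orbT.
    have h7 : b * d <= a * N by rewrite -(leq_pmul2l n0); lia.
    case: #|J :\ j| J0 h3 => // q _ /=; lia.
- by apply: (IH J G kap') => //; lia.
Qed.

(** * Binomial inequalities and the largest ratio *)

(** With m = n - r, the next step multiplies the binomial by (m - k) / m, and (m - k) (n + (r + 1)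
    k) <= m (n + r k) because m <= n. *)
Lemma bin_sub_bound n k r : r <= n ->
  'C(n - r, k) * (n + r * k) <= 'C(n, k) * n.
Proof.
elim: r => [|r IH] rn; first by rewrite subn0 addn0.
have {}IH := IH (ltnW rn); have e := mul_bin_down (n - r) k.
rewrite subnS; move: e IH; set x := 'C(n - r, k); set y := 'C(_.-1, k).
move=> e IH; have q0 : 0 < n - r by rewrite subn_gt0.
rewrite -(leq_pmul2l q0).
have h : (n - r) * (x * (n + r * k)) <= (n - r) * ('C(n, k) * n).
  by rewrite leq_mul2l IH orbT.
apply: leq_trans h; rewrite !mulnA e.
rewrite [(n - r) * x]mulnC [(_ - k) * x]mulnC -!mulnA leq_mul2l; apply/orP; right.
case: (leqP (n - r) k) => hk; first by rewrite (eqP hk) mul0n.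
have [d dE] : exists d, n - r = k + d by exists (n - r - k); lia.
have dn : d <= n by lia.
by rewrite dE addKn; nia.
Qed.

(* Which alternative holds is decided by comparing k_i / n_i with k_j / (n_j - m). *)
Lemma bin_exchange ni nj ki kj m : m < ni -> m < nj ->
  'C(nj - m.+1, kj) * 'C(ni, ki) <= 'C(nj - m, kj) * 'C(ni.-1, ki) \/
  'C(ni - m.+1, ki) * 'C(nj, kj) <= 'C(nj - m, kj) * 'C(ni.-1, ki).
Proof.
move=> mi mj; case: (leqP (ki * (nj - m)) (kj * ni)) => h; [left|right].
  have e1 := mul_bin_down (nj - m) kj; have e2 := mul_bin_down ni ki.
  have q0 : 0 < (nj - m) * ni by rewrite muln_gt0 subn_gt0 mj; lia.
  rewrite subnS -(leq_pmul2l q0).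
  rewrite (_ : (nj - m) * ni * ('C((nj - m).-1, kj) * 'C(ni, ki)) =
    (nj - m) * 'C((nj - m).-1, kj) * (ni * 'C(ni, ki))); last by lia.
  rewrite (_ : (nj - m) * ni * ('C(nj - m, kj) * 'C(ni.-1, ki)) =
    (nj - m) * 'C(nj - m, kj) * (ni * 'C(ni.-1, ki))); last by lia.
  rewrite e1 e2; case: (leqP ki ni) => [le|lt]; last first.
    by rewrite (bin_small lt) !muln0.
  set x := 'C(_, kj); set y := 'C(_, ki).
  have : (nj - m - kj) * ni <= (nj - m) * (ni - ki) by nia.
  by move=> h'; have := leq_mul (leqnn (x * y)) h'; lia.
(* The comparison at [m] gives kj (ni - t - 1) <= ki (nj - t) for every t < m, so passing from t to
   t + 1 shrinks the left side at least as much as the right. *)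
have : forall t, t <= m ->
    'C(ni - t.+1, ki) * 'C(nj, kj) <= 'C(nj - t, kj) * 'C(ni.-1, ki); last by apply.
elim=> [|t IH] tm; first by rewrite subn0 subn1 mulnC.
have {}IH := IH (ltnW tm).
have e1 := mul_bin_down (nj - t) kj; have e2 := mul_bin_down (ni - t.+1) ki.
rewrite (subnS ni) (subnS nj).
move: IH e1 e2; set x := 'C(ni - t.+1, ki); set y := 'C(nj - t, kj).
set A := 'C(nj, kj); set B := 'C(ni.-1, ki).
set x' := 'C(_.-1, ki); set y' := 'C(_.-1, kj).
have : kj * (ni - t.+1) <= ki * (nj - t) by nia.
have : 0 < (nj - t) * (ni - t.+1) by rewrite muln_gt0; lia.
move: (nj - t) (ni - t.+1) => p q pq0 le IH e1 e2.
rewrite -(leq_pmul2l pq0).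
have -> : p * q * (x' * A) = p * (q - ki) * (x * A).
  by rewrite -!mulnA (mulnA q x') e2 !mulnA.
have -> : p * q * (y' * B) = q * (p - kj) * (y * B).
  by rewrite (mulnC p q) -!mulnA (mulnA p y') e1 !mulnA.
by apply: leq_mul => //; nia.
Qed.

(** The weight [w j] is k_j / n_j times the product of all n_i. *)
Lemma exists_max_ratio (I : finType) (i0 : I) (k n : I -> nat) :
  (forall i, 0 < n i) -> exists j, forall i, k i * n j <= k j * n i.
Proof.
move=> n0; pose w j := k j * \prod_(i | i != j) n i.
have [j _ jmax] := @arg_maxnP I i0 xpredT w isT.
exists j => i; have := jmax i isT; rewrite /w /=.
have Pj : \prod_e n e = n j * \prod_(e | e != j) n e by rewrite (bigD1 j).
have Pi : \prod_e n e = n i * \prod_(e | e != i) n e by rewrite (bigD1 i).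
have P0 : 0 < \prod_i n i by rewrite prodn_gt0.
move: Pi Pj P0; rewrite /=; set P := \prod_i n i.
set Qi := \prod_(e | e != i) n e; set Qj := \prod_(e | e != j) n e => ei ej P0 le.
rewrite -(leq_pmul2r P0) [X in k i * _ * X]ei [X in k j * _ * X]ej.
have := leq_mul (leqnn (n i * n j)) le; lia.
Qed.

(** * The sharp threshold, by deletion of vertices *)

(** A member of the smaller product outside [avoid G D] is already missing from [G]. *)
Lemma card_complement_avoid (T : finType) (l : nat) (V : 'I_l -> {set T})
    (k : 'I_l -> nat) (G : {set {set T}}) (D : {set T}) :
  G \subset direct_product V k ->
  #|direct_product (fun i => V i :\: D) k| - #|avoid G D| <=
  #|direct_product V k| - #|G|.
Proof.
move=> GV; rewrite -!cardsDS ?avoid_direct_product //; apply: subset_leq_card.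
apply/subsetP=> X; rewrite in_setD => /andP[XG XV].
have XD : [disjoint X & D].
  apply: disjointWl (direct_product_sub XV) _.
  by rewrite disjoints_subset; apply/bigcupsP=> i _; rewrite setDE subsetIr.
rewrite inE; apply/andP; split.
  by apply: contra XG => XG; rewrite inE XG.
rewrite inE; apply/andP; split.
  apply: subset_trans (direct_product_sub XV) _.
  by apply/bigcupsP=> i _; apply: subset_trans (subsetDl _ _) (bigcup_sup i _).
apply/forallP=> i; rewrite -(direct_product_card i XV) setIDA.
by have /setDidPl -> : [disjoint X :&: V i & D] by apply: disjointWl XD; apply: subsetIl.
Qed.

(** The sharp threshold is phrased through missing sets, whose number does not grow when a vertex is
    deleted; only the binomial bounds then need comparing. *)
Lemma rainbow_of_small_complement (T I : finType) (l : nat) (k : 'I_l -> nat)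
    (V : 'I_l -> {set T}) (J : {set I}) (F : I -> {set {set T}}) :
  0 < l -> (forall i, 0 < k i) -> pairwise_disjoint V ->
  (forall i, 8 * l * #|J| * k i ^ 2 <= #|V i|) ->
  (forall j, j \in J -> F j \subset direct_product V k) ->
  (forall j i, j \in J -> #|direct_product V k| - #|F j| <
    'C(#|V i| - #|J|.-1, k i) * \prod_(e < l | e != i) 'C(#|V e|, k e)) ->
  rainbow J F.
Proof.
move=> l0 k0; move sJ : #|J| => s.
elim: s => [|s IH] in V J F sJ *; move=> disjV nk FV compl.
  by exists (fun=> set0); split=> j; rewrite (cards0_eq sJ) inE.
have n0 i : 0 < #|V i|.
  by apply: leq_trans (nk i); rewrite !muln_gt0 l0 k0.
have [x hx] := exists_max_ratio (Ordinal l0) k n0.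
have /card_gt0P[v0 v0x] := n0 x.
have v0V : v0 \in \bigcup_(i < l) V i by apply/bigcupP; exists x.
have kx8 : 8 * (s * k x) <= #|V x|.
  apply: leq_trans (nk x); move: (k0 x); case: (k x) => // y _; case: (l) l0 => // q _.
  by nia.
apply: (@rainbow_step _ _ _ V k (k x) #|V x| J F (fun=> k) v0) => //.
- by move=> i; rewrite sJ.
(* Now |J| = s + 1 and p = k_x / n_x. The bound at part [x] gives |F j| > s p N / (1 + s p), and 8 s
   p <= 1 makes this at least (8/9) s p N, enough for 3/7. *)
- move=> j jJ; rewrite sJ /=; have := compl j x jJ; rewrite /=.
  have sx : s <= #|V x| by have := k0 x; nia.
  have := bin_sub_bound (k x) sx.
  set N := #|direct_product V k|; have : N = 'C(#|V x|, k x) * \prod_(e < l | e != x) 'C(#|V e|, k e).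
    by rewrite /N card_direct_product // (bigD1 x).
  move: (\prod_(e < l | e != x) _) => R; move: kx8.
  move: #|V x| (k x) #|F j| 'C(_ - s, _) 'C(_, _) (n0 x) => b a f B A b0 ab NE h1 h2.
  have [B0 R0] : 0 < B /\ 0 < R by move: h2; case: (B) => [|B']; case: (R) => [|R'] //; rewrite ?muln0; lia.
  have h3 : B * (b + s * a) * R <= A * b * R by rewrite leq_mul2r h1 orbT.
  have h4 : (N - f) * (b + s * a) < B * R * (b + s * a).
    by rewrite ltn_mul2r h2 andbT; lia.
  have h5 : (N - f) * (b + s * a) < N * b by rewrite NE in h4 *; lia.
  case: (leqP N f) => hNf.
    have : 3 * (s * a) * N < 7 * b * N by rewrite ltn_mul2r; nia.
    have : 7 * b * N <= 7 * b * f by rewrite leq_mul2l hNf orbT.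
    by lia.
  have [g gE] : exists g, N = f + g by exists (N - f); lia.
  move: h5; rewrite gE addKn => h5.
  have h6 : 8 * (s * a) * f <= b * f by rewrite leq_mul2r ab orbT.
  have f0 : 0 < f by move: h5; case: (f) => // ; nia.
  have h7 : 0 < b * f by rewrite muln_gt0 b0.
  by nia.
- move=> j v jJ /bigcupP[c _ vc].
  have cJ : #|J :\ j| = s by move: sJ; rewrite (cardsD1 j J) jJ => -[].
  have JJ i : i \in J :\ j -> i \in J by case/setD1P.
  have Vc : #|V c :\ v| = #|V c|.-1 by rewrite [in RHS](cardsD1 v) vc.
  have VE e : e != c -> V e :\ v = V e.
    move=> ec; apply/setDidPl; rewrite disjoint_sym disjoints1; apply/negP=> ve.
    by have /pred0P/(_ v)/= := disjV _ _ ec; rewrite ve vc.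
  apply: (IH (fun i => V i :\: [set v])) => //.
  + exact: pairwise_disjointD.
  + move=> i; have := nk i; have := k0 i; have := cardsD1 v (V i).
    by case: (v \in V i) => -> //; case: (k i) => // y _; case: (l) l0 => // q _; nia.
  + by move=> i /JJ iJ; apply/avoid_direct_product/FV.
  + move=> i e iJj; have iJ := JJ i iJj.
    apply: leq_ltn_trans (card_complement_avoid [set v] (FV i iJ)) _.
    have /card_gt0P : exists i, i \in J :\ j by exists i.
    rewrite cJ => s0; have sE := prednK s0; set m := s.-1 in sE *.
    (* In the part of the deleted vertex, one vertex fewer and one family fewer cancel: n_c - 1 - m
       = n_c - (m + 1). *)
    case: (eqVneq e c) => [->|ec].
      rewrite Vc (eq_bigr (fun e => 'C(#|V e|, k e))) => [|e' ?]; last by rewrite VE.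
      have := compl i c iJ; rewrite /= -sE.
      by have -> : #|V c| - m.+1 = #|V c|.-1 - m by lia.
    (* In another part [e], the new bound is at least the old one for [e] or the old one for [c], by
       [bin_exchange]. *)
    rewrite VE // (bigD1 c) /=; last by rewrite eq_sym.
    rewrite Vc (eq_bigr (fun e => 'C(#|V e|, k e))); last by move=> e' /andP[_ ?]; rewrite VE.
    have ms y : m < #|V y|.
      apply: leq_trans (nk y); rewrite sE; have := k0 y; case: (k y) => // z _.
      by case: (l) l0 => // q _; nia.
    have := compl i e iJ; have := compl i c iJ; rewrite -sE /=.
    rewrite (bigD1 e) //= [in X in _ -> X -> _](bigD1 c) /=; last by rewrite eq_sym.
    rewrite (eq_bigl (fun f => (f != e) && (f != c))) => [|f]; last by rewrite andbC.
    rewrite !mulnA => h1 h2.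
    case: (bin_exchange (k c) (k e) (ms c) (ms e)) => h.
      by apply: leq_trans h2 _; rewrite leq_mul2r h orbT.
    by apply: leq_trans h1 _; rewrite leq_mul2r h orbT.
- move=> G kap' GV kk big _.
  apply: (@rainbow_of_dense _ _ _ V k (k x) #|V x| J G kap' v0) => //.
  by move=> i; rewrite sJ.
Qed.

Theorem theorem1p5 (l s : nat) (n k : 'I_l -> nat)
    (hl : 0 < l) (hs : 0 < s)
    (hn : forall i : 'I_l, 0 < n i) (hk : forall i : 'I_l, 0 < k i)
    (hnk : forall i : 'I_l, 8 * l ^ 2 * (k i) ^ 2 * s <= n i)
    (T : finType) (V : 'I_l -> {set T})
    (hV : pairwise_disjoint V) (hcard : forall i : 'I_l, #|V i| = n i)
    (F : 'I_s -> {set {set T}})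
    (hF : forall t : 'I_s, F t \subset direct_product V k)
    (hfree : rainbow_matching_free F) :
  exists t : 'I_s,
    #|F t| <= \max_(i < l)
      (('C(n i, k i) - 'C(n i - s + 1, k i)) *
       \prod_(j < l | j != i) 'C(n j, k j)).
Proof.
apply/existsP; apply: contra_notT hfree => /existsPn big.
have sT : #|[set: 'I_s]| = s by rewrite cardsT card_ord.
have [||t i _|M [MF Md]] := @rainbow_of_small_complement _ _ l k V [set: 'I_s] F hl hk hV.
- move=> i; rewrite sT hcard; apply: leq_trans (hnk i).
  by move: (k i ^ 2) => q; case: (l) hl => // m _; nia.
- by move=> t _.
- have RE : \prod_(e < l | e != i) 'C(#|V e|, k e) = \prod_(e < l | e != i) 'C(n e, k e).
    by apply: eq_bigr => e _; rewrite hcard.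
  have NE : #|direct_product V k| =
      'C(n i, k i) * \prod_(e < l | e != i) 'C(n e, k e).
    by rewrite card_direct_product // (bigD1 i) //= RE hcard.
  have := big t; rewrite -ltnNge; move/(leq_ltn_trans (leq_bigmax i)).
  have := subset_leq_card (hF t); rewrite sT NE RE hcard mulnBl.
  (* With truncated subtraction the two forms agree because 0 < s <= n_i. *)
  have -> : n i - s.-1 = n i - s + 1.
    by have := hnk i; have := hk i; case: (k i) => // q _; case: (l) hl => // m _; nia.
  have le : 'C(n i - s + 1, k i) <= 'C(n i, k i) by apply: leq_bin2l; have := hn i; lia.
  by have := leq_mul le (leqnn (\prod_(e < l | e != i) 'C(n e, k e))); lia.
- by exists M; split=> [t|t t' tt']; [apply: MF | apply: Md]; rewrite ?inE.
Qed.
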